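(* Let $\mathcal P$ be a symmetric operad and $V$ a $\mathcal P$-algebra. Composition through the second color defines an associative multiplication on the coequalizer $\mathcal P_+(-,1)^2\circ_{\mathcal P}(V,\Bbbk)$ (that is, on $\partial\mathcal P\circ_{\mathcal P}V$), and the resulting associative algebra is canonically isomorphic to the universal enveloping algebra $\mathsf U_{\mathcal P}(V)$ of the $\mathcal P$-algebra $V$ in the sense of Ginzburg and Kapranov.
   Context: $\Bbbk$ is a field of characteristic zero; operads are $\Bbbk$-linear symmetric operads $\mathcal P=\{\mathcal P(n)\}_{n\ge 1}$ without $0$-ary operations. The colored operad $\mathcal P_+$: it has two colors $\{1,2\}$; $\mathcal P_+(m,n)^c$ denotes operations with $m$ inputs of color 1, $n$ inputs of color 2 and output of color $c$. One sets $\mathcal P_+(m,0)^1=\mathcal P(m)$, $\mathcal P_+(m,n)^1=0$ for $n\ge 1$; $\mathcal P_+(m,n)^2=0$ unless $n=1$; and $\mathcal P_+(n,1)^2=\{\partial\gamma:\gamma\in\mathcal P(n+1)\}\cong\partial\mathcal P(n):=\mathrm{Res}^{\mathbb S_{n+1}}_{\mathbb S_n}\mathcal P(n+1)$, where $\partial\gamma$ is $\gamma$ with its first input and its output recolored in color 2. Compositions are determined by $(\partial\gamma)\circ^1_i\delta=\partial(\gamma\circ_{i+1}\delta)$ (through the first color, $\delta\in\mathcal P$) and $(\partial\gamma)\circ^2_1(\partial\delta)=\partial(\gamma\circ_1\delta)$ (through the second color). Here $\mathcal P_+(-,1)^2\circ_{\mathcal P}(V,M)$, for a vector space $M$, is the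 coequalizer of the two maps $\mathcal P_+^2\circ\mathcal P\circ(V,M)\rightrightarrows\mathcal P_+^2(V,M)$ given respectively by the action of $\mathcal P$ on $V$ and by composition through the first color in $\mathcal P_+$, where $\mathcal P_+^2(V,M)=\bigoplus_{n\ge0}\mathcal P_+(n,1)^2\otimes_{\mathbb S_n}V^{\otimes n}\otimes M$. Universal enveloping algebra of Ginzburg–Kapranov: $\mathsf U_{\mathcal P}(V)$ is the associative algebra generated by symbols $X(\gamma;v_1,\dots,v_n)$, $n\ge0$, $\gamma\in\mathcal P(n+1)$, $v_i\in V$, multilinear in all arguments, subject to $X(\sigma(\gamma);v_1,\dots,v_n)=X(\gamma;v_{\sigma(1)},\dots,v_{\sigma(n)})$ for $\sigma\in\mathbb S_n\subset\mathbb S_{n+1}$ permuting the last $n$ inputs, to $X(\gamma\circ_{i+1}\delta;v_1,\dots,v_{n+m-1})=X(\gamma;v_1,\dots,\delta(v_i,\dots,v_{i+m-1}),\dots,v_{n+m-1})$ for $\gamma\in\mathcal P(n+1)$, $\delta\in\mathcal P(m)$, $1\le i\le n$, with the product given by concatenation through the first input: $X(\gamma;v_1,\dots,v_n)\cdot X(\delta;w_1,\dots,w_m)=X(\delta\circ_1\gamma;v_1,\dots,v_n,w_1,\dots,w_m)$ (unit $X(\mathrm{id})$). Accordingly the product of the classes of $\partial\gamma\otimes v$ and $\partial\delta\otimes w$ in the coequalizer is the class of $(\partial\delta)\circ^2_1(\partial\gamma)\otimes(v\otimes w)$. *)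

(* Defs.v *)
From HB Require Import structures.
From mathcomp Require Import all_boot all_fingroup all_algebra.
From mathcomp Require Import generic_quotient finmap boolp.
From mathcomp Require Import zify.
From mathcomp Require Export monalg.

Set Implicit Arguments.
Unset Strict Implicit.
Unset Printing Implicit Defensive.

Import GRing.Theory.

Local Open Scope ring_scope.
Local Open Scope quotient_scope.

(* Linear quotients: [linquot E] is T modulo the span of the differences
   a - b with E a b. *)

Section LinearQuotient.
Context {k : fieldType} {T : lmodType k}.
Variable E : T -> T -> Prop.

Inductive lincong : T -> T -> Prop :=
| lincong_base a b : E a b -> lincong a b
| lincong_refl a : lincong a a
| lincong_sym a b : lincong a b -> lincong b a
| lincong_trans a b c : lincong a b -> lincong b c -> lincong a c
| lincong_add a b c d :
    lincong a b -> lincong c d -> lincong (a + c) (b + d)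
| lincong_scale r a b : lincong a b -> lincong (r *: a) (r *: b).

Definition lincongb (a b : T) : bool := `[< lincong a b >].

Fact lincongb_equiv : equiv_class_of lincongb.
Proof.
split=> [a|a b|b a c]; first by apply/asboolP; exact: lincong_refl.
  by apply/asboolP/asboolP; exact: lincong_sym.
by move=> /asboolP ab /asboolP bc; apply/asboolP; exact: lincong_trans ab bc.
Qed.

Canonical lincong_equiv := EquivRelPack lincongb_equiv.

Definition linquot := {eq_quot lincong_equiv}.

HB.instance Definition _ := Choice.on linquot.
HB.instance Definition _ := EqQuotient.on linquot.

Definition lclass (a : T) : linquot := \pi a.

Lemma lclassP (a b : T) : lclass a = lclass b <-> lincong a b.
Proof.
split=> [/eqP|ab]; first by rewrite /lclass eqmodE => /asboolP.
by apply/eqP; rewrite /lclass eqmodE; apply/asboolP.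
Qed.

Lemma lclass_repr (x : linquot) : lclass (repr x) = x.
Proof. exact: reprK. Qed.

Lemma lclass_ind (Q : linquot -> Prop) :
  (forall a, Q (lclass a)) -> forall x, Q x.
Proof. by move=> Qc x; rewrite -(lclass_repr x). Qed.

Lemma repr_lclass (a : T) : lincong (repr (lclass a)) a.
Proof. by apply/lclassP; rewrite lclass_repr. Qed.

Definition linquot_add (x y : linquot) := lclass (repr x + repr y).
Definition linquot_opp (x : linquot) := lclass (- repr x).
Definition linquot_scale (r : k) (x : linquot) := lclass (r *: repr x).

Lemma linquot_addE a b : linquot_add (lclass a) (lclass b) = lclass (a + b).
Proof. by apply/lclassP; apply: lincong_add; exact: repr_lclass. Qed.

Lemma linquot_oppE a : linquot_opp (lclass a) = lclass (- a).
Proof.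
by apply/lclassP; rewrite -!scaleN1r; apply: lincong_scale; exact: repr_lclass.
Qed.

Lemma linquot_scaleE r a : linquot_scale r (lclass a) = lclass (r *: a).
Proof. by apply/lclassP; apply: lincong_scale; exact: repr_lclass. Qed.

Fact linquot_addA : associative linquot_add.
Proof.
by elim/lclass_ind=> a; elim/lclass_ind=> b; elim/lclass_ind=> c;
   rewrite !linquot_addE addrA.
Qed.

Fact linquot_addC : commutative linquot_add.
Proof.
by elim/lclass_ind=> a; elim/lclass_ind=> b; rewrite !linquot_addE addrC.
Qed.

Fact linquot_add0 : left_id (lclass 0) linquot_add.
Proof. by elim/lclass_ind=> a; rewrite linquot_addE add0r. Qed.

Fact linquot_addN : left_inverse (lclass 0) linquot_opp linquot_add.
Proof. by elim/lclass_ind=> a; rewrite linquot_oppE linquot_addE addNr. Qed.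

HB.instance Definition _ := GRing.isZmodule.Build linquot
  linquot_addA linquot_addC linquot_add0 linquot_addN.

Fact linquot_scaleA r s x :
  linquot_scale r (linquot_scale s x) = linquot_scale (r * s) x.
Proof. by elim/lclass_ind: x => a; rewrite !linquot_scaleE scalerA. Qed.

Fact linquot_scale1 : left_id 1 linquot_scale.
Proof. by elim/lclass_ind=> a; rewrite linquot_scaleE scale1r. Qed.

Fact linquot_scaleDr : right_distributive linquot_scale +%R.
Proof.
move=> r; elim/lclass_ind=> a; elim/lclass_ind=> b; rewrite /GRing.add /=.
by rewrite !(linquot_addE, linquot_scaleE) scalerDr.
Qed.

Fact linquot_scaleDl x : {morph linquot_scale^~ x : r s / r + s}.
Proof.
move=> r s; elim/lclass_ind: x => a; rewrite [RHS]/GRing.add /=.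
by rewrite !(linquot_addE, linquot_scaleE) scalerDl.
Qed.

HB.instance Definition _ := GRing.Zmodule_isLmodule.Build k linquot
  linquot_scaleA linquot_scale1 linquot_scaleDr linquot_scaleDl.

Fact lclass_is_linear : linear lclass.
Proof.
by move=> r a b; rewrite -linquot_addE -linquot_scaleE.
Qed.

HB.instance Definition _ := GRing.isLinear.Build k T linquot *:%R lclass
  lclass_is_linear.

End LinearQuotient.

Arguments linquot {k T} E.
Arguments lclass {k T} E a.

(* The coequalizer of (the linear extensions of) two maps f, g : X -> T.  If X
   is a spanning set of a vector space S, on all of which f and g are linear,
   this is the coequalizer of S => T. *)

Definition coeq_rel (k : fieldType) (T : lmodType k) (X : Type) (f g : X -> T)
  (a b : T) : Prop := exists x : X, a = f x /\ b = g x.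

Notation coequalizer f g := (linquot (coeq_rel f g)).

Section FreeAlgebra.
Context {k : fieldType} {G : choiceType}.

Definition free_alg := {malg k[{fmonom G}]}.

HB.instance Definition _ := GRing.Lalgebra.on free_alg.

Fact free_alg_scalerAr (r : k) (a b : free_alg) : r *: (a * b) = a * (r *: b).
Proof.
have scalemr (p q : {malg k[{fmonom G}]}) : r *: (p * q) = p * (r *: q).
  rewrite (malgMEw (fsubset_refl _) (msuppZ_le r q)) malgME scaler_sumr.
  apply: eq_bigr => i _; rewrite scaler_sumr; apply: eq_bigr => j _.
  rewrite mcoeffZ mulrCA; apply/malgP => l.
  by rewrite mcoeffZ [in LHS]mcoeffU [in RHS]mcoeffU mulrnAr.
exact: scalemr.
Qed.

HB.instance Definition _ := GRing.Lalgebra_isAlgebra.Build k free_alg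
  free_alg_scalerAr.

End FreeAlgebra.

Arguments free_alg : clear implicits.

(* Locked so that unification does not unfold it. *)
HB.lock Definition free_gen (k : fieldType) (G : choiceType) (g : G) :
  free_alg k G := << fmu g >>.

(* [algquot E] is the algebra A modulo the two-sided ideal generated by the
   differences a - b with E a b.  It may be zero, so that it is only a
   [pzRingType]. *)

Section AlgebraQuotient.
Context {k : fieldType} {A : algType k}.
Variable E : A -> A -> Prop.

Definition ideal_rel (a b : A) : Prop :=
  exists l r c d : A, [/\ E c d, a = l * c * r & b = l * d * r].

Definition algquot := linquot ideal_rel.

HB.instance Definition _ := GRing.Lmodule.on algquot.

Definition aclass (a : A) : algquot := lclass ideal_rel a.

Fact aclass_is_linear : linear aclass.
Proof. exact: lclass_is_linear. Qed.

HB.instance Definition _ := GRing.isLinear.Build k A algquot *:%R aclass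
  aclass_is_linear.

Lemma ideal_cong_mulr a b c :
  lincong ideal_rel a b -> lincong ideal_rel (a * c) (b * c).
Proof.
elim=> {a b} [a b [l [r [x [y [xy -> ->]]]]]|a|a b _ ab|a b d _ ab _ bd
             |a b d e _ ab _ de|r a b _ ab].
- by apply: lincong_base; exists l, (r * c), x, y; rewrite !mulrA.
- exact: lincong_refl.
- exact: lincong_sym.
- exact: lincong_trans ab bd.
- by rewrite !mulrDl; exact: lincong_add.
- by rewrite -!scalerAl; exact: lincong_scale.
Qed.

Lemma ideal_cong_mull a b c :
  lincong ideal_rel a b -> lincong ideal_rel (c * a) (c * b).
Proof.
elim=> {a b} [a b [l [r [x [y [xy -> ->]]]]]|a|a b _ ab|a b d _ ab _ bd
             |a b d e _ ab _ de|r a b _ ab].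
- by apply: lincong_base; exists (c * l), r, x, y; rewrite !mulrA.
- exact: lincong_refl.
- exact: lincong_sym.
- exact: lincong_trans ab bd.
- by rewrite !mulrDr; exact: lincong_add.
- by rewrite -!scalerAr; exact: lincong_scale.
Qed.

Definition algquot_mul (x y : algquot) : algquot := aclass (repr x * repr y).

Lemma algquot_mulE a b : algquot_mul (aclass a) (aclass b) = aclass (a * b).
Proof.
apply/lclassP; apply: (@lincong_trans _ _ _ _ (a * repr (aclass b))).
  by apply: ideal_cong_mulr; exact: repr_lclass.
by apply: ideal_cong_mull; exact: repr_lclass.
Qed.

Lemma aclass_base a b : E a b -> aclass a = aclass b.
Proof.
by move=> ab; apply/lclassP/lincong_base; exists 1, 1, a, b; rewrite !mul1r !mulr1.
Qed.

Lemma aclass_ind (Q : algquot -> Prop) :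
  (forall a, Q (aclass a)) -> forall x, Q x.
Proof. exact: lclass_ind. Qed.

Fact algquot_mulA : associative algquot_mul.
Proof.
by elim/aclass_ind=> a; elim/aclass_ind=> b; elim/aclass_ind=> c;
   rewrite !algquot_mulE mulrA.
Qed.

Fact algquot_mul1 : left_id (aclass 1) algquot_mul.
Proof. by elim/aclass_ind=> a; rewrite algquot_mulE mul1r. Qed.

Fact algquot_mulr1 : right_id (aclass 1) algquot_mul.
Proof. by elim/aclass_ind=> a; rewrite algquot_mulE mulr1. Qed.

Fact algquot_mulDl : left_distributive algquot_mul +%R.
Proof.
by elim/aclass_ind=> a; elim/aclass_ind=> b; elim/aclass_ind=> c;
   rewrite -raddfD !algquot_mulE mulrDl raddfD.
Qed.

Fact algquot_mulDr : right_distributive algquot_mul +%R.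
Proof.
by elim/aclass_ind=> a; elim/aclass_ind=> b; elim/aclass_ind=> c;
   rewrite -raddfD !algquot_mulE mulrDr raddfD.
Qed.

HB.instance Definition _ := GRing.Zmodule_isPzRing.Build algquot
  algquot_mulA algquot_mul1 algquot_mulr1 algquot_mulDl algquot_mulDr.

Lemma aclassM : {morph aclass : a b / a * b}.
Proof. by move=> a b; rewrite -algquot_mulE. Qed.

Lemma algquot_scalerAl (r : k) (x y : algquot) : r *: (x * y) = (r *: x) * y.
Proof.
elim/aclass_ind: x => a; elim/aclass_ind: y => b.
by rewrite -aclassM -!linearZ -aclassM scalerAl.
Qed.

Lemma algquot_scalerAr (r : k) (x y : algquot) : r *: (x * y) = x * (r *: y).
Proof.
elim/aclass_ind: x => a; elim/aclass_ind: y => b.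
by rewrite -aclassM -!linearZ -aclassM scalerAr.
Qed.

End AlgebraQuotient.

Arguments algquot {k A} E.
Arguments aclass {k A} E a.

Definition bilinear_op (k : fieldType) (A : lmodType k) (mul : A -> A -> A) :=
  (forall y, linear (mul^~ y)) /\ (forall x, linear (mul x)).

Definition assoc_algebra (k : fieldType) (A : lmodType k)
    (mul : A -> A -> A) (one : A) : Prop :=
  [/\ bilinear_op mul, associative mul, left_id one mul & right_id one mul].

(* Substituting an operation with m.+1 inputs for input i of an operation with
   N inputs gives N + m inputs: input l of the former becomes input
   [inner i l], and input k != i of the latter becomes input [outer m i k]. *)

Section Inputs.
Variables (N m : nat).

Fact inner_proof (i : 'I_N) (l : 'I_m.+1) : (i + l < N + m)%N.
Proof. by rewrite -addSn leq_add // -ltnS. Qed.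
Definition inner (i : 'I_N) (l : 'I_m.+1) : 'I_(N + m) :=
  Ordinal (inner_proof i l).

Fact outer_proof (i k : 'I_N) : ((if k < i then k : nat else k + m) < N + m)%N.
Proof. by case: ifP => _; rewrite ?ltn_add2r // ltn_addr. Qed.
Definition outer (i k : 'I_N) : 'I_(N + m) := Ordinal (outer_proof i k).

Definition plug (V : Type) (i : 'I_N) (u : {ffun 'I_(N + m) -> V})
    (f : {ffun 'I_m.+1 -> V} -> V) : {ffun 'I_N -> V} :=
  [ffun k => if k == i then f [ffun l => u (inner i l)] else u (outer i k)].

End Inputs.

Arguments outer {N} m i k.

Section Families.
Variables (k : fieldType) (V : lmodType k).

Definition vset n (v : {ffun 'I_n -> V}) (i : 'I_n) (x : V) :
  {ffun 'I_n -> V} := [ffun j => if j == i then x else v j].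

Definition vperm n (s : 'S_n) (v : {ffun 'I_n -> V}) : {ffun 'I_n -> V} :=
  [ffun i => v (s i)].

(* v_1, ..., v_n, w_1, ..., w_m; the length is written m + n to match the
   arity of a composite in which the v's are inputs of the inner operation. *)
Definition vcat m n (v : {ffun 'I_n -> V}) (w : {ffun 'I_m -> V}) :
    {ffun 'I_(m + n) -> V} :=
  [ffun i => match split (cast_ord (addnC m n) i) with
             | inl a => v a
             | inr b => w b
             end].

Definition vseq n (s : seq V) : {ffun 'I_n -> V} := [ffun i : 'I_n => nth 0 s i].

Definition multilinear (W : lmodType k) n (f : {ffun 'I_n -> V} -> W) : Prop :=
  forall v i, linear (fun x => f (vset v i x)).

End Families.

(* [block_perm s t i r]: r is the permutation of the inputs of a composite
   along input i induced by permuting the outer inputs by s and the inner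
   inputs by t. *)

Definition block_perm m n (s : 'S_m.+1) (t : 'S_n.+1) (i : 'I_m.+1)
    (r : 'S_(m + n).+1) : Prop :=
  (forall l : 'I_n.+1, r (inner i l) = inner (s i) (t l)) /\
  (forall j : 'I_m.+1, j != i -> r (outer n i j) = outer n (s i) (s j)).

Section BlockPerm.
Variables (N m : nat).
Implicit Types (i j : 'I_N) (l : 'I_m.+1).

Lemma inner_inj i : injective (inner i : 'I_m.+1 -> 'I_(N + m)).
Proof. by move=> l l' /(congr1 val) /= /addnI /val_inj. Qed.

Lemma outer_inj i j j' :
  j != i -> j' != i -> outer m i j = outer m i j' -> j = j'.
Proof.
move=> ji j'i /(congr1 val) /= e; apply: val_inj => /=; move: e ji j'i.
rewrite -!val_eqE /=; case: (ltngtP j i); case: (ltngtP j' i) => //; lia.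
Qed.

Lemma inner_outer i j l : j != i -> inner i l != outer m i j.
Proof.
rewrite -!val_eqE /=; have := ltn_ord l; case: (ltngtP j i) => //; lia.
Qed.

Lemma input_cases i (z : 'I_(N + m)) :
  {l | z = inner i l} + {j | j != i & z = outer m i j}.
Proof.
case: (ltnP z i) => [zi|iz].
  right; exists (Ordinal (ltn_trans zi (ltn_ord i))).
    by rewrite -val_eqE /= ltn_eqF.
  by apply: val_inj; rewrite /= zi.
case: (ltnP (z - i) m.+1) => [zim|zim].
  by left; exists (Ordinal zim); apply: val_inj; rewrite /= subnKC.
have zN : (z - m < N)%N by have := ltn_ord z; have := ltn_ord i; lia.
right; exists (Ordinal zN); first by rewrite -val_eqE /=; lia.
by apply: val_inj => /=; case: ifP; lia.
Qed.

End BlockPerm.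

Lemma block_perm_exists m n (s : 'S_m.+1) (t : 'S_n.+1) (i : 'I_m.+1) :
  exists r, block_perm s t i r.
Proof.
pose f (z : 'I_(m + n).+1) : 'I_(m + n).+1 :=
  match @input_cases m.+1 n i z with
  | inl (exist l _) => inner (s i) (t l)
  | inr (exist2 j _ _) => outer n (s i) (s j)
  end.
have sne j : j != i -> s j != s i by rewrite (inj_eq perm_inj).
have f_in l : f (inner i l) = inner (s i) (t l).
  rewrite /f; case: input_cases => [[l' /inner_inj ->]|[j ji e]] //.
  by move: (inner_outer l ji); rewrite e eqxx.
have f_out j : j != i -> f (outer n i j) = outer n (s i) (s j).
  move=> ji; rewrite /f; case: input_cases => [[l e]|[j' j'i e]].
    by move: (inner_outer l ji); rewrite e eqxx.
  by rewrite (outer_inj ji j'i e).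
have f_inj : injective f.
  move=> z z'.
  case: (@input_cases m.+1 n i z) => [[l ->]|[j ji ->]];
  case: (@input_cases m.+1 n i z') => [[l' ->]|[j' j'i ->]].
  - by rewrite !f_in => e; rewrite (perm_inj (@inner_inj m.+1 n (s i) _ _ e)).
  - rewrite f_in (f_out _ j'i) => /eqP.
    by rewrite (negbTE (inner_outer _ (sne _ j'i))).
  - rewrite f_in (f_out _ ji) => /esym /eqP.
    by rewrite (negbTE (inner_outer _ (sne _ ji))).
  - rewrite !f_out // => e.
    by rewrite (perm_inj (@outer_inj m.+1 n (s i) _ _ (sne _ ji) (sne _ j'i) e)).
exists (perm f_inj); split=> [l|j ji]; rewrite permE; first exact: f_in.
exact: f_out.
Qed.

(* [P n] is the space P(n+1) of operations with n+1 inputs, so that there are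
   no operations without inputs.  Inputs are numbered from 0: [ocomp x i y] is
   x o_(i+1) y.  The action is the left action (s x)(v_1, ..., v_n) =
   x(v_(s 1), ..., v_(s n)); the product s * t in 'S_n is "s, then t", whence
   the order in [operad_actM]. *)

Record operad (k : fieldType) := Operad {
  operad_space :> nat -> lmodType k;
  oact : forall n, 'S_n.+1 -> operad_space n -> operad_space n;
  idop : operad_space 0;
  ocomp : forall m n,
    operad_space m -> 'I_m.+1 -> operad_space n -> operad_space (m + n);
  operad_act_linear : forall n (s : 'S_n.+1), linear (@oact n s);
  operad_act1 : forall n (x : operad_space n), oact 1%g x = x;
  operad_actM : forall n (s t : 'S_n.+1) (x : operad_space n),
    oact (s * t)%g x = oact t (oact s x);
  operad_comp_linearl : forall m n (i : 'I_m.+1) (y : operad_space n),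
    linear (fun x : operad_space m => ocomp x i y);
  operad_comp_linearr : forall m n (x : operad_space m) (i : 'I_m.+1),
    linear (fun y : operad_space n => ocomp x i y);
  operad_idl : forall n (x : operad_space n), ocomp idop ord0 x = x;
  operad_idr : forall n (x : operad_space n) (i : 'I_n.+1),
    ocomp x i idop = ecast j (operad_space j) (esym (addn0 n)) x;
  operad_sequential : forall m n p (x : operad_space m) (y : operad_space n)
      (z : operad_space p) (i : 'I_m.+1) (j : 'I_n.+1),
    ecast l (operad_space l) (esym (addnA m n p))
      (ocomp (ocomp x i y) (inner i j) z)
    = ocomp x i (ocomp y j z);
  operad_parallel : forall m n p (x : operad_space m) (y : operad_space n)
      (z : operad_space p) (i j : 'I_m.+1), i != j ->
    ecast l (operad_space l) (addnAC m n p)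
      (ocomp (ocomp x i y) (outer n i j) z)
    = ocomp (ocomp x j z) (outer p j i) y;
  operad_equivariant : forall m n (x : operad_space m) (y : operad_space n)
      (s : 'S_m.+1) (t : 'S_n.+1) (i : 'I_m.+1) (r : 'S_(m + n).+1),
    block_perm s t i r ->
    ocomp (oact s x) (s i) (oact t y) = oact r (ocomp x i y)
}.

Arguments idop {k} o.

Record operad_algebra (k : fieldType) (P : operad k) := OperadAlgebra {
  operad_algebra_space :> lmodType k;
  eval : forall n, P n ->
    {ffun 'I_n.+1 -> operad_algebra_space} -> operad_algebra_space;
  eval_linear : forall n v, linear (fun x : P n => eval x v);
  eval_multilinear : forall n (x : P n), multilinear (eval x);
  eval_id : forall v, eval (idop P) v = v ord0;
  eval_act : forall n (s : 'S_n.+1) (x : P n) v,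
    eval (oact s x) v = eval x (vperm s v);
  eval_comp : forall m n (x : P m) (i : 'I_m.+1) (y : P n) v,
    eval (ocomp x i y) v = eval x (plug i v (eval y))
}.

(* The subgroup S_n of S_(n+1) fixing the first input. *)
Definition fix_first n (s : 'S_n) : 'S_n.+1 := lift_perm ord0 ord0 s.

(* The colored operad P_+: [Pplus P c m n] is P_+(m, n)^c. *)

Inductive color := color1 | color2.

Section Pplus.
Variables (k : fieldType) (P : operad k).

Definition Pplus (c : color) (m n : nat) : lmodType k :=
  match c with
  | color1 => match n with
              | 0 => match m with m'.+1 => P m' | 0 => 'rV[k]_0 end
              | _.+1 => 'rV[k]_0
              end
  | color2 => match n with 1 => P m | _ => 'rV[k]_0 end
  end.

Definition partial_op n (x : P n) : Pplus color2 n 1 := x.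

Definition Pplus_act n (s : 'S_n) (x : Pplus color2 n 1) : Pplus color2 n 1 :=
  @oact k P n (fix_first s) x.

(* (d x) o^1_i y = d (x o_(i+1) y); input i of color 1 of d x is input i+1 of
   x, the first input of x having been given color 2. *)
Definition Pplus_comp1 n m (x : Pplus color2 n 1) (i : 'I_n)
    (y : Pplus color1 m.+1 0) : Pplus color2 (n + m) 1 :=
  @ocomp k P n m x (lift ord0 i) y.

(* (d x) o^2_1 (d y) = d (x o_1 y) *)
Definition Pplus_comp2 m n (x : Pplus color2 m 1) (y : Pplus color2 n 1) :
    Pplus color2 (m + n) 1 :=
  @ocomp k P m n x ord0 y.

(* Simultaneous composition through the first color: y_0, ..., y_r are
   substituted for the inputs p, ..., p + r of color 1, the last one first, so
   that the positions still to be filled do not move.  [insub] is only ever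
   applied to valid positions. *)
Fixpoint Pplus_comp1s n (x : Pplus color2 n 1) (p : nat)
    (ys : seq {m & Pplus color1 m.+1 0}) : {N & Pplus color2 N 1} :=
  if ys is y :: ys' then
    let x' := Pplus_comp1s x p.+1 ys' in
    Tagged (fun N => Pplus color2 N 1)
      (oapp (fun i => Pplus_comp1 (tagged x') i (tagged y)) 0 (insub p))
  else Tagged (fun N => Pplus color2 N 1) x.

End Pplus.

Arguments partial_op {k} P {n} x.

(* P_+^2(V, M) = (+)_n P_+(n,1)^2 (x)_(S_n) V^(x)n (x) M, presented by the
   pure tensors. *)

Section Pplus2.
Variables (k : fieldType) (P : operad k) (V M : lmodType k).

Record tensor2 := Tensor2 {
  tensor2_arity : nat;
  tensor2_op : Pplus P color2 tensor2_arity 1;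
  tensor2_args : {ffun 'I_tensor2_arity -> V};
  tensor2_coef : M
}.

HB.instance Definition _ := gen_eqMixin tensor2.
HB.instance Definition _ := gen_choiceMixin tensor2.

Definition free2 n (x : Pplus P color2 n 1) (v : {ffun 'I_n -> V}) (z : M) :
  {malg k[tensor2]} := << Tensor2 x v z >>.

Inductive Pplus2_rel : {malg k[tensor2]} -> {malg k[tensor2]} -> Prop :=
| Pplus2_op n (a : k) (x y : Pplus P color2 n 1) v z :
    Pplus2_rel (free2 (a *: x + y) v z) (a *: free2 x v z + free2 y v z)
| Pplus2_arg n (x : Pplus P color2 n 1) v (i : 'I_n) (a : k) (u w : V) z :
    Pplus2_rel (free2 x (vset v i (a *: u + w)) z)
      (a *: free2 x (vset v i u) z + free2 x (vset v i w) z)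
| Pplus2_coef n (x : Pplus P color2 n 1) v (a : k) (z t : M) :
    Pplus2_rel (free2 x v (a *: z + t)) (a *: free2 x v z + free2 x v t)
| Pplus2_sym n (s : 'S_n) (x : Pplus P color2 n 1) v z :
    Pplus2_rel (free2 (Pplus_act s x) v z) (free2 x (vperm s v) z).

Definition Pplus2 : lmodType k := linquot Pplus2_rel.

Definition pure2 n (x : Pplus P color2 n 1) (v : {ffun 'I_n -> V}) (z : M) :
  Pplus2 := lclass Pplus2_rel (free2 x v z).

End Pplus2.

(* The coequalizer P_+(-,1)^2 o_P (V, M) of
   P_+^2 o P o (V, M) => P_+^2(V, M).  The source is spanned by the pure
   tensors  d x (x) (y_1 (x) u_1) (x) ... (x) (y_n (x) u_n) (x) z  with
   y_i in P_+(m_i, 0)^1 = P(m_i) and u_i in V^m_i, on which the two maps are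
   given. *)

Section RelativeComposite.
Variables (k : fieldType) (P : operad k) (V : operad_algebra P).
Variable M : lmodType k.

Record tensor1 := Tensor1 {
  tensor1_pred_arity : nat;
  tensor1_op : Pplus P color1 tensor1_pred_arity.+1 0;
  tensor1_args : {ffun 'I_tensor1_pred_arity.+1 -> V}
}.

Record tensor21 := Tensor21 {
  tensor21_arity : nat;
  tensor21_op : Pplus P color2 tensor21_arity 1;
  tensor21_args : {ffun 'I_tensor21_arity -> tensor1};
  tensor21_coef : M
}.

Definition action_map (t : tensor21) : Pplus2 P V M :=
  pure2 (tensor21_op t)
    [ffun i => let y := tensor21_args t i in
               @eval k P V _ (tensor1_op y) (tensor1_args y)]
    (tensor21_coef t).

Definition composition_map (t : tensor21) : Pplus2 P V M :=
  let ys := codom (tensor21_args t) in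
  let x := Pplus_comp1s (tensor21_op t) 0
    [seq Tagged (fun m => Pplus P color1 m.+1 0) (tensor1_op y) | y <- ys] in
  pure2 (tagged x)
    (vseq (tag x) (flatten [seq codom (tensor1_args y) | y <- ys]))
    (tensor21_coef t).

Definition relcomp : lmodType k := coequalizer action_map composition_map.

Definition relclass n (x : Pplus P color2 n 1) (v : {ffun 'I_n -> V}) (z : M) :
  relcomp := lclass (coeq_rel action_map composition_map) (pure2 x v z).

End RelativeComposite.

(* P_+(-,1)^2 o_P (V, k), and the class of d x (x) v = d x (x) v (x) 1. *)

Definition dP_circ (k : fieldType) (P : operad k) (V : operad_algebra P) :
  lmodType k := relcomp V k^o.

Definition dP_class (k : fieldType) (P : operad k) (V : operad_algebra P) n
    (x : Pplus P color2 n 1) (v : {ffun 'I_n -> V}) : dP_circ V :=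
  @relclass k P V k^o n x v 1.

(* The product induced by composition through the second color:
   [d x (x) v] [d y (x) w] = [(d y) o^2_1 (d x) (x) (v (x) w)]. *)

Definition second_color_product (k : fieldType) (P : operad k)
    (V : operad_algebra P) (mul : dP_circ V -> dP_circ V -> dP_circ V) : Prop :=
  bilinear_op mul /\
  forall n m (x : Pplus P color2 n 1) (y : Pplus P color2 m 1)
    (v : {ffun 'I_n -> V}) (w : {ffun 'I_m -> V}),
    mul (dP_class x v) (dP_class y w) =
    dP_class (Pplus_comp2 y x) (vcat v w).

(* [Uenv V] is the universal enveloping algebra U_P(V) of Ginzburg and Kapranov;
   [Xgen x v] is its generator X(x; v_1, ..., v_n), for x in P(n+1). *)

Section EnvelopingAlgebra.
Variables (k : fieldType) (P : operad k) (V : operad_algebra P).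

Record usymbol := USymbol {
  usymbol_arity : nat;
  usymbol_op : P usymbol_arity;
  usymbol_args : {ffun 'I_usymbol_arity -> V}
}.

HB.instance Definition _ := gen_eqMixin usymbol.
HB.instance Definition _ := gen_choiceMixin usymbol.

Definition freeX n (x : P n) (v : {ffun 'I_n -> V}) :
  free_alg k usymbol := free_gen k (USymbol x v).

Inductive U_rel : free_alg k usymbol -> free_alg k usymbol -> Prop :=
| U_op n (a : k) (x y : P n) v :
    U_rel (freeX (a *: x + y) v) (a *: freeX x v + freeX y v)
| U_arg n (x : P n) v (i : 'I_n) (a : k) (u w : V) :
    U_rel (freeX x (vset v i (a *: u + w)))
      (a *: freeX x (vset v i u) + freeX x (vset v i w))
| U_sym n (s : 'S_n) (x : P n) v :
    U_rel (freeX (oact (fix_first s) x) v) (freeX x (vperm s v))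
| U_comp n m (x : P n) (i : 'I_n) (y : P m) (v : {ffun 'I_(n + m) -> V}) :
    U_rel (freeX (ocomp x (lift ord0 i) y) v)
      (freeX x (plug i v (@eval k P V m y)))
| U_mul n m (x : P n) (y : P m) v w :
    U_rel (freeX x v * freeX y w) (freeX (ocomp y ord0 x) (vcat v w))
| U_one v : U_rel (freeX (idop P) v) 1.

Definition Uenv := algquot U_rel.

HB.instance Definition _ := GRing.Lmodule.on Uenv.
HB.instance Definition _ := GRing.PzRing.on Uenv.

Definition Xgen n (x : P n) (v : {ffun 'I_n -> V}) : Uenv :=
  aclass U_rel (freeX x v).

End EnvelopingAlgebra.

(* Main.v *)
Require Import Defs.
From HB Require Import structures.
From mathcomp Require Import all_boot all_fingroup all_algebra.
From mathcomp Require Import generic_quotient finmap zify.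

Set Implicit Arguments.
Unset Strict Implicit.
Unset Printing Implicit Defensive.

Import GRing.Theory.
Local Open Scope ring_scope.

(** Both sides classify the same data.  Call a family of values
   F(x; v_1, ..., v_n), x in P(n+1), balanced if it satisfies the relations that
   U_P(V) imposes on its generators, those that involve the product excepted.
   The coequalizer dP o_P V is the universal target of a balanced family
   ([balanced_class], [dP_lift]).  Its relations are stated for simultaneous
   substitutions; they are equivalent to those for a single substitution, which
   is what [balanced] asks for: iterate single substitutions in one direction
   ([balanced_comp1s]), substitute units in the other ([dP_class_comp]).

   The formula for the product, (x, v).(y, w) = (y o_1 x, v w), is balanced in
   (y, w) by the parallel and equivariance axioms of the operad, so left
   multiplication by a class is a well-defined endomorphism of dP o_P V.  The
   free algebra on the symbols X(x; v) thus acts on dP o_P V.  The action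
   descends to U_P(V) because the formula is also balanced in (x, v),
   associative and unital ([act_rel]).  Acting on the class of the unit
   of P gives a linear map U_P(V) -> dP o_P V that sends X(x; v) to the class of
   (x, v).

   In the other direction the generators X(x; v) form a balanced family, whence
   a map dP o_P V -> U_P(V).  It is linear over U_P(V) and preserves the units,
   so the two maps are inverse to each other.  The product of dP o_P V is then
   transported from U_P(V), and is determined by its values on classes because
   these span. *)

(** * Linear maps out of free modules, quotients and free algebras *)

Section LinearExtension.
Context {k : fieldType} {K : choiceType} {W : lmodType k}.
Implicit Types (f : K -> W) (g : {malg k[K]}).

Definition malg_lift f g : W := \sum_(x <- msupp g) g@_x *: f x.

Lemma malg_liftEw f g (d : {fset K}) :
  (msupp g `<=` d)%fset -> malg_lift f g = \sum_(x <- d) g@_x *: f x.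
Proof.
move=> sgd; rewrite /malg_lift; apply: big_fset_incl => // x _ xg.
by rewrite mcoeff_outdom // scale0r.
Qed.

Fact malg_lift_is_linear f : linear (malg_lift f).
Proof.
move=> a g h; pose d := (msupp g `|` msupp h)%fset.
have sg : (msupp g `<=` d)%fset by exact: fsubsetUl.
have sh : (msupp h `<=` d)%fset by exact: fsubsetUr.
have sgh : (msupp (a *: g + h) `<=` d)%fset.
  apply: fsubset_trans (msuppD_le _ _) _.
  by rewrite fsetSU // msuppZ_le.
rewrite (malg_liftEw f sg) (malg_liftEw f sh) (malg_liftEw f sgh).
rewrite scaler_sumr -big_split /=; apply: eq_bigr => x _.
by rewrite mcoeffD mcoeffZ scalerDl scalerA.
Qed.

HB.instance Definition _ f :=
  GRing.isLinear.Build k {malg k[K]} W *:%R (malg_lift f)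
    (malg_lift_is_linear f).

Lemma malg_liftU f x : malg_lift f << x >> = f x.
Proof.
rewrite (malg_liftEw f msuppU_le) big_seq_fset1.
by rewrite mcoeffUU scale1r.
Qed.

Lemma malg_ind (Q : {malg k[K]} -> Prop) :
  Q 0 -> (forall a g h, Q g -> Q h -> Q (a *: g + h)) ->
  (forall x, Q << x >>) -> forall g, Q g.
Proof.
move=> Q0 QD QU g; rewrite (monalgE g); elim/big_ind: _ => [//|g1 g2 Q1 Q2|x _].
  by rewrite -(scale1r g1); apply: QD.
have -> : << g@_x *g x >> = g@_x *: << x >> + 0.
  by apply/malgP=> y; rewrite addr0 mcoeffZ !mcoeffU mulrnAr mulr1.
exact: QD.
Qed.

End LinearExtension.

Section QuotientLift.
Context {k : fieldType} {T W : lmodType k} {E : T -> T -> Prop}.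

Variable f : {linear T -> W}.
Hypothesis fE : forall a b, E a b -> f a = f b.

Lemma lincong_eq a b : lincong E a b -> f a = f b.
Proof.
elim=> {a b} [a b /fE|a|a b _ ->|a b c _ -> _ ->|a b c d _ e1 _ e2
             |r a b _ e] //.
  by rewrite !linearD e1 e2.
by rewrite !linearZ e.
Qed.

(** Opaque, as are the maps built from it: unification would otherwise unfold
   them when it compares two of their values. *)
Lemma linquot_lift_spec :
  {g : {linear linquot E -> W} | forall a, g (lclass E a) = f a}.
Proof.
pose g (x : linquot E) : W := f (repr x).
have gE a : g (lclass E a) = f a by exact/lincong_eq/repr_lclass.
have g_linear : linear g.
  move=> r x y; rewrite -(lclass_repr x) -(lclass_repr y).
  by rewrite -linearP !gE linearP.
pose gL : {linear linquot E -> W} := HB.pack g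
  (GRing.isLinear.Build k (linquot E) W *:%R g g_linear).
by exists gL.
Qed.

Definition linquot_lift : {linear linquot E -> W} := sval linquot_lift_spec.

Lemma linquot_liftE a : linquot_lift (lclass E a) = f a.
Proof. exact: (svalP linquot_lift_spec). Qed.

End QuotientLift.

Section FreeAlgebraInduction.
Context {k : fieldType} {G : choiceType}.

Lemma free_alg_basis_ind (Q : free_alg k G -> Prop) :
  Q 0 -> (forall r (a b : free_alg k G), Q a -> Q b -> Q (r *: a + b)) ->
  (forall m : {fmonom G}, Q (mkmalgU m 1)) -> forall a, Q a.
Proof. exact: malg_ind. Qed.

Lemma free_alg_mulU (m n : {fmonom G}) :
  (mkmalgU m 1 : free_alg k G) * mkmalgU n 1 = mkmalgU (fmmul m n) 1.
Proof. by rewrite [LHS]fgmulUU mulr1. Qed.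

Lemma free_alg_ind (Q : free_alg k G -> Prop) :
  Q 0 -> (forall r (a b : free_alg k G), Q a -> Q b -> Q (r *: a + b)) ->
  Q 1 -> (forall g (a : free_alg k G), Q a -> Q (free_gen k g * a)) ->
  forall a, Q a.
Proof.
move=> Q0 QD Q1 QM; apply: free_alg_basis_ind => //.
case; elim=> [|g s IHs].
  by rewrite -fmoneE; exact: Q1.
have -> : mkmalgU (FMonom (g :: s)) 1 =
    free_gen k g * (mkmalgU (FMonom s) 1 : free_alg k G).
  rewrite free_gen.unlock free_alg_mulU; congr (mkmalgU _ 1).
  by rewrite fmmulE fmuE.
exact: QM.
Qed.

End FreeAlgebraInduction.

(** A family of endomorphisms of W indexed by G makes W a left module over the
   free algebra on G. *)
Section FreeAction.
Context {k : fieldType} {G : choiceType} {W : lmodType k}.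
Variable T : G -> {linear W -> W}.

Definition word_act (m : {fmonom G}) (x : W) : W := foldr (fun g => T g) x m.

Definition free_act (a : free_alg k G) (x : W) : W :=
  malg_lift (fun m => word_act m x) a.

Fact free_act_is_linear a : linear (free_act a).
Proof.
move=> r x y; rewrite /free_act /malg_lift scaler_sumr -big_split /=.
apply: eq_bigr => m _; rewrite scalerA mulrC -scalerA -scalerDr; congr (_ *: _).
by rewrite /word_act; elim: (m : seq G) => //= g s ->; rewrite linearP.
Qed.

HB.instance Definition _ a :=
  GRing.isLinear.Build k W W *:%R (free_act a) (free_act_is_linear a).

Lemma free_act_linearl x : linear (free_act^~ x).
Proof. move=> r a b; exact: malg_lift_is_linear. Qed.

(** The same value with the vector fixed, as a linear map of the scalar. *)
Definition free_orbit x (a : free_alg k G) : W := free_act a x.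

HB.instance Definition _ x :=
  GRing.isLinear.Build k (free_alg k G) W *:%R (free_orbit x)
    (free_act_linearl x).

Lemma free_act0 x : free_act 0 x = 0.
Proof. exact: raddf0. Qed.

Lemma free_actU m x : free_act (mkmalgU m 1) x = word_act m x.
Proof. exact: malg_liftU. Qed.

Lemma free_act1 x : free_act 1 x = x.
Proof. by apply: etrans (free_actU (fmone G) x) _; rewrite /word_act fm1. Qed.

Lemma free_act_gen g x : free_act (free_gen k g) x = T g x.
Proof. by rewrite free_gen.unlock free_actU /word_act fmU. Qed.

Lemma free_actM a b x : free_act (a * b) x = free_act a (free_act b x).
Proof.
move: a; apply: free_alg_basis_ind => [|r a a' IHa IHa'|m].
- by rewrite mul0r !free_act0.
- by rewrite mulrDl -scalerAl !free_act_linearl; congr (_ *: _ + _).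
move: b; apply: free_alg_basis_ind => [|r b b' IHb IHb'|n].
- by rewrite mulr0 free_act0 linear0.
- rewrite mulrDr -scalerAr !free_act_linearl linearP.
  by congr (_ *: _ + _).
rewrite free_alg_mulU !free_actU /word_act.
by rewrite fmM foldr_cat.
Qed.

(** If the relations E hold between the endomorphisms of W, the map a |-> a.x
   factors through the quotient of the free algebra by the ideal they
   generate. *)
Lemma free_orbit_ideal (E : free_alg k G -> free_alg k G -> Prop) x :
  (forall a b, E a b -> free_act a =1 free_act b) ->
  forall a b, ideal_rel E a b -> free_orbit x a = free_orbit x b.
Proof.
move=> TE a b [l [r [c [d [cd -> ->]]]]]; rewrite /free_orbit.
have actM e :
    free_act (l * e * r) x = free_act l (free_act e (free_act r x)).
  by rewrite (free_actM (l * e) r x) (free_actM l e).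
apply: etrans (actM c) (etrans _ (esym (actM d))).
by congr (free_act l); exact: TE.
Qed.

End FreeAction.

(** * Families of vectors as functions of a natural number *)

(** Composites related by the operad axioms have arities that are equal without
   being convertible, so families of arguments are compared entry by entry at
   natural-number indices, where [lia] decides which block an index lies in. *)
Section FamiliesAsSequences.
Context {k : fieldType} {V : lmodType k}.

Definition vnth n (v : {ffun 'I_n -> V}) (a : nat) : V := oapp v 0 (insub a).

Lemma vnth_ord n (v : {ffun 'I_n -> V}) (i : 'I_n) : vnth v i = v i.
Proof. by rewrite /vnth valK. Qed.

Lemma vnthE n (v : {ffun 'I_n -> V}) a (an : (a < n)%N) :
  vnth v a = v (Ordinal an).
Proof. by rewrite -vnth_ord. Qed.

Lemma eq_vnth n (v w : {ffun 'I_n -> V}) :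
  (forall a, (a < n)%N -> vnth v a = vnth w a) -> v = w.
Proof. by move=> vw; apply/ffunP=> i; rewrite -!vnth_ord vw. Qed.

Lemma vnth_vseq n (s : seq V) a : (a < n)%N -> vnth (vseq n s) a = nth 0 s a.
Proof. by move=> an; rewrite (vnthE _ an) ffunE. Qed.

Lemma vnth_vset n (v : {ffun 'I_n -> V}) i x a :
  vnth (vset v i x) a = if a == i :> nat then x else vnth v a.
Proof.
rewrite /vnth; case: insubP => [j _ <-|] /=; first by rewrite ffunE.
by case: eqP => // ->; rewrite ltn_ord.
Qed.

Lemma vnth_vcat m n (v : {ffun 'I_n -> V}) (w : {ffun 'I_m -> V}) a :
  (a < m + n)%N ->
  vnth (vcat v w) a = if (a < n)%N then vnth v a else vnth w (a - n).
Proof.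
move=> amn; rewrite (vnthE _ amn) ffunE.
by case: split_ordP => j /(congr1 val) /= ->;
  rewrite ?ltn_ord ?vnth_ord // ltnNge leq_addr /= addKn vnth_ord.
Qed.

Lemma vnth_plug N m (i : 'I_N) (u : {ffun 'I_(N + m) -> V}) f a :
  (a < N)%N ->
  vnth (plug i u f) a =
    if a == i :> nat then f [ffun l : 'I_m.+1 => vnth u (i + l)]
    else vnth u (if (a < i)%N then a else a + m)%N.
Proof.
move=> aN; rewrite (vnthE _ aN) ffunE -val_eqE /=.
case: eqP => _; last by rewrite -vnth_ord.
by congr f; apply/ffunP=> l; rewrite !ffunE -vnth_ord.
Qed.

Definition recast n n' (v : {ffun 'I_n -> V}) : {ffun 'I_n' -> V} :=
  [ffun i : 'I_n' => vnth v i].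

Lemma vnth_recast n n' (v : {ffun 'I_n -> V}) a :
  (a < n')%N -> vnth (recast n' v) a = vnth v a.
Proof. by move=> an; rewrite (vnthE _ an) ffunE. Qed.

End FamiliesAsSequences.

Lemma vperm1 (k : fieldType) (V : lmodType k) n (v : {ffun 'I_n -> V}) :
  vperm 1%g v = v.
Proof. by apply/ffunP=> i; rewrite ffunE perm1. Qed.

(** * Balanced families *)

Lemma fix_firstE n (s : 'S_n.+1) :
  s ord0 = ord0 -> exists t : 'S_n, s = fix_first t.
Proof.
move=> s0.
have s_lift i : exists j, s (lift ord0 i) = lift ord0 j.
  case: (unliftP ord0 (s (lift ord0 i))) => [j ->|]; first by exists j.
  by rewrite -[RHS]s0 => /perm_inj /eqP; rewrite -(inj_eq val_inj).
pose f i := odflt i (unlift ord0 (s (lift ord0 i))).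
have fE i : s (lift ord0 i) = lift ord0 (f i).
  by have [j e] := s_lift i; rewrite /f e liftK.
have f_inj : injective f.
  by move=> i j fij; apply: (@lift_inj _ ord0); apply: (@perm_inj _ s);
     rewrite !fE fij.
exists (perm f_inj); apply/permP=> i.
case: (unliftP ord0 i) => [j ->|->]; last by rewrite lift_perm_id.
by rewrite lift_perm_lift permE fE.
Qed.

Section Balanced.
Context {k : fieldType} {P : operad k} {V : operad_algebra P}.

(** A balanced family is a value F(x; v_1, ..., v_n) subject to exactly the
   relations that U_P(V) imposes on its generators, apart from those that
   involve the product.  The relative composite will turn out to be universal
   among them. *)
Record balanced (W : lmodType k)
    (F : forall n, P n -> {ffun 'I_n -> V} -> W) : Prop := Balanced {
  balanced_op : forall n v, linear (fun x : P n => F n x v);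
  balanced_arg : forall n (x : P n), multilinear (F n x);
  balanced_sym : forall n (s : 'S_n) (x : P n) v,
    F n (oact (fix_first s) x) v = F n x (vperm s v);
  balanced_comp : forall n m (x : P n) (i : 'I_n) (y : P m)
      (v : {ffun 'I_(n + m) -> V}),
    F (n + m)%N (ocomp x (lift ord0 i) y) v = F n x (plug i v (eval y))
}.

(** Operad axioms hold up to a cast of arities.  Inside a family the cast moves
   to the arguments, where it does not change the entries; the two versions
   serve the two sides on which an axiom may carry its cast. *)
Lemma cast_family (W : Type) (F : forall n, P n -> {ffun 'I_n -> V} -> W)
    n n' (e : n = n') (x : P n) (x' : P n') v :
  ecast j (P j) e x = x' -> F n x v = F n' x' (recast n' v).
Proof.
case: n' / e x' => x' /= ->; congr (F _ _ _).
by apply: eq_vnth => a an; rewrite vnth_recast.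
Qed.

Lemma cast_familyV (W : Type) (F : forall n, P n -> {ffun 'I_n -> V} -> W)
    n n' (e : n = n') (x : P n) (x' : P n') v :
  ecast j (P j) e x = x' -> F n' x' v = F n x (recast n v).
Proof.
case: n' / e x' v => x' v /= ->; congr (F _ _ _).
by apply: eq_vnth => a an; rewrite vnth_recast.
Qed.

Section Product.
Context {W : lmodType k}.
Variable F : forall n, P n -> {ffun 'I_n -> V} -> W.
Hypothesis balF : balanced F.
Implicit Types (n m p : nat).

(** The formula for the product of the classes of (x, v) and (y, w), with values
   in an arbitrary family F. *)
Definition product_family n (x : P n) (v : {ffun 'I_n -> V}) m (y : P m)
  (w : {ffun 'I_m -> V}) : W := F (ocomp y ord0 x) (vcat v w).

(** Permuting the inputs of x and of y separately is a block permutation of the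
   inputs of the composite; it fixes the first input because both permutations
   do, so that F absorbs it. *)
Lemma product_family_sym n (x : P n) v m (y : P m) w (t : 'S_n) (s : 'S_m) :
  product_family (oact (fix_first t) x) v (oact (fix_first s) y) w =
  product_family x (vperm t v) y (vperm s w).
Proof.
have ff0 q (r : 'S_q) : fix_first r ord0 = ord0 by exact: lift_perm_id.
have [r rP] := block_perm_exists (fix_first s) (fix_first t) ord0.
rewrite /product_family -[in LHS](ff0 _ s) (operad_equivariant _ _ rP).
case: rP => r_in r_out.
have r0 : r ord0 = ord0.
  have -> : ord0 = inner ord0 ord0 :> 'I_(m + n).+1 by exact: val_inj.
  by rewrite r_in !ff0.
have [r' rE] := fix_firstE r0; rewrite rE balanced_sym //; congr F.
have r'E j : (r' j).+1 = r (lift ord0 j) :> nat.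
  by rewrite rE lift_perm_lift lift0.
apply/ffunP=> j; rewrite [LHS]ffunE.
case: (ltnP j n) => jn.
  rewrite -[RHS]vnth_ord vnth_vcat // jn (vnthE _ jn) [RHS]ffunE.
  have r'j : r' j = t (Ordinal jn) :> nat.
    apply: succn_inj; rewrite r'E.
    have -> : lift ord0 j =
        inner ord0 (lift ord0 (Ordinal jn)) :> 'I_(m + n).+1.
      exact: val_inj.
    by rewrite r_in ff0 lift_perm_lift.
  by rewrite -[LHS]vnth_ord vnth_vcat // r'j ltn_ord vnth_ord.
have jm : (j - n < m)%N by have := ltn_ord j; lia.
rewrite -[RHS]vnth_ord vnth_vcat // ltnNge jn /= (vnthE _ jm) [RHS]ffunE.
have r'j : r' j = (s (Ordinal jm) + n)%N :> nat.
  apply: succn_inj; rewrite r'E.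
  have -> : lift ord0 j =
      outer n ord0 (lift ord0 (Ordinal jm)) :> 'I_(m + n).+1.
    by apply: val_inj; rewrite /= /bump /=; lia.
  by rewrite r_out // ff0 lift_perm_lift.
rewrite -[LHS]vnth_ord vnth_vcat // r'j.
by rewrite ltnNge leq_addl /= addnK vnth_ord.
Qed.

(** Balanced in (y, w): substitution into an input of y other than the first
   commutes with substitution of x into the first one, by the parallel
   composition axiom. *)
Lemma balanced_left n (x : P n) (v : {ffun 'I_n -> V}) :
  balanced (product_family x v).
Proof.
split.
- move=> m w a y y'; rewrite /product_family operad_comp_linearl.
  exact: (balanced_op balF).
- move=> m y w i a u u'; rewrite /product_family.
  have ni : (n + i < m + n)%N by rewrite addnC ltn_add2r.
  have E z : vcat v (vset w i z) = vset (vcat v w) (Ordinal ni) z.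
    apply: eq_vnth => b bmn; rewrite vnth_vset !vnth_vcat // vnth_vset /=.
    case: ltnP => bn; first by case: eqP => //; lia.
    by congr (if _ then _ else _); lia.
  by rewrite !E; apply: (balanced_arg balF).
- move=> m s y w.
  have e1 : oact (fix_first 1%g) x = x.
    by rewrite /fix_first lift_perm1 operad_act1.
  by rewrite -[in LHS]e1 product_family_sym vperm1.
- move=> m p y i z w; rewrite /product_family.
  have ni : (n + i < m + n)%N by rewrite addnC ltn_add2r.
  pose i' := Ordinal ni.
  have := operad_parallel y z x (i := lift ord0 i) (j := ord0) isT.
  have -> : outer p (lift ord0 i) ord0 = ord0 :> 'I_(m + p).+1.
    exact: val_inj.
  have -> : outer n ord0 (lift ord0 i) = lift ord0 i' :> 'I_(m + n).+1.
    by apply: val_inj; rewrite /= /bump /=; lia.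
  move=> /(cast_family F) ->; rewrite (balanced_comp balF); congr F.
  apply: eq_vnth => a amn; rewrite vnth_plug // vnth_vcat //=.
  case: (ltnP a n) => an.
    case: eqP => [|_]; first lia.
    have -> : (a < n + i)%N by lia.
    rewrite vnth_recast ?vnth_vcat ?an //; lia.
  have a'm : (a - n < m)%N by lia.
  rewrite vnth_plug //; have -> : (a == n + i)%N = (a - n == i)%N by lia.
  case: eqP => ai.
    congr (eval z _); apply/ffunP=> l; rewrite !ffunE.
    have lt_l := ltn_ord l; have lt_i := ltn_ord i.
    rewrite vnth_recast ?vnth_vcat; try lia.
    by have -> : (n + i + l < n)%N = false; [lia | congr vnth; lia].
  have -> : (a < n + i)%N = (a - n < i)%N by lia.
  have lt_i := ltn_ord i.
  case: ltnP => ai'; rewrite vnth_recast ?vnth_vcat; try lia.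
    by rewrite ltnNge an.
  by have -> : (a + p < n)%N = false; [lia | congr vnth; lia].
Qed.

(** Balanced in (x, v): substitution into x before or after composing with y
   agree by the sequential composition axiom. *)
Lemma balanced_right m (y : P m) (w : {ffun 'I_m -> V}) :
  balanced (fun n (x : P n) v => product_family x v y w).
Proof.
split.
- move=> n v a x x'; rewrite /product_family operad_comp_linearr.
  exact: (balanced_op balF).
- move=> n x v i a u u'; rewrite /product_family.
  have ni : (i < m + n)%N by rewrite ltn_addl.
  have E z : vcat (vset v i z) w = vset (vcat v w) (Ordinal ni) z.
    apply: eq_vnth => b bmn; rewrite vnth_vset !vnth_vcat // vnth_vset /=.
    by case: ltnP => bn //; case: eqP => // ?; have := ltn_ord i; lia.
  by rewrite !E; apply: (balanced_arg balF).
- move=> n t x v.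
  have e1 : oact (fix_first 1%g) y = y.
    by rewrite /fix_first lift_perm1 operad_act1.
  by rewrite -[in LHS]e1 product_family_sym vperm1.
- move=> n p x i z v; rewrite /product_family.
  have lt_i := ltn_ord i.
  have ni : (i < m + n)%N by rewrite ltn_addl.
  pose i' := Ordinal ni.
  have := operad_sequential y x z ord0 (lift ord0 i).
  have -> : inner ord0 (lift ord0 i) = lift ord0 i' :> 'I_(m + n).+1.
    exact: val_inj.
  move=> /(cast_familyV F) ->; rewrite (balanced_comp balF); congr F.
  apply: eq_vnth => a amn; rewrite vnth_plug // vnth_vcat //=.
  case: (ltnP a n) => an; last first.
    have -> : (a == i)%N = false by lia.
    have -> : (a < i)%N = false by lia.
    rewrite vnth_recast ?vnth_vcat; try lia.
    by have -> : (a + p < n + p)%N = false; [lia | congr vnth; lia].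
  rewrite vnth_plug //; case: eqP => ai.
    congr (eval z _); apply/ffunP=> l; rewrite !ffunE.
    have lt_l := ltn_ord l.
    rewrite vnth_recast ?vnth_vcat; try lia.
    by have -> : (i + l < n + p)%N by lia.
  by case: ltnP => ai'; rewrite vnth_recast ?vnth_vcat; try lia;
     case: ifP => //; lia.
Qed.

Lemma product_familyA n (x : P n) v m (y : P m) w p (z : P p) u :
  product_family x v (ocomp z ord0 y) (vcat w u) =
  product_family (ocomp y ord0 x) (vcat v w) z u.
Proof.
rewrite /product_family.
have := operad_sequential z y x ord0 ord0.
have -> : inner ord0 ord0 = ord0 :> 'I_(p + m).+1 by exact: val_inj.
move=> /(cast_family F) ->; congr F.
apply: eq_vnth => a am; rewrite vnth_recast // [LHS]vnth_vcat; last lia.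
rewrite [RHS]vnth_vcat //.
case: (ltnP a n) => an.
  have -> : (a < m + n)%N by lia.
  by rewrite vnth_vcat ?an //; lia.
rewrite vnth_vcat; last lia.
have -> : (a - n < m)%N = (a < m + n)%N by lia.
case: ltnP => amn; last by congr vnth; lia.
by rewrite vnth_vcat // ltnNge an.
Qed.

Lemma product_family1 (v : {ffun 'I_0 -> V}) m (y : P m) w :
  product_family (idop P) v y w = F y w.
Proof.
have /esym/(cast_family F) -> := operad_idr y ord0.
congr F; apply: eq_vnth => a am; rewrite vnth_vcat //= ?vnth_recast //; try lia.
by congr vnth; lia.
Qed.

Lemma product_familyr1 n (x : P n) v (w : {ffun 'I_0 -> V}) :
  product_family x v (idop P) w = F x v.
Proof.
rewrite /product_family (operad_idl x); congr F.
by apply: eq_vnth => a am; rewrite vnth_vcat // am.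
Qed.

End Product.
End Balanced.

(** * The universal property of the relative composite *)

Section Universal.
Context {k : fieldType} {P : operad k} {V : operad_algebra P}.

Notation color1_op := (Tagged (fun m => Pplus P color1 m.+1 0)).

Lemma comp1s_arity n (x : Pplus P color2 n 1) p ys :
  (n <= tag (Pplus_comp1s x p ys))%N.
Proof.
by elim: ys p => //= y ys IH p; apply: leq_trans (IH p.+1) (leq_addr _ _).
Qed.

Section Substitution.
Context {W : lmodType k}.
Variable F : forall n, P n -> {ffun 'I_n -> V} -> W.
Hypothesis balF : balanced F.

(** Iterating single substitutions gives the simultaneous one that defines the
   coequalizer.  The prefix s lists the arguments before position p, which are
   not touched: substitutions are made from the last position down. *)
Lemma balanced_comp1s n (x : P n) p (ts : seq (tensor1 V)) (s : seq V) :
  size s = p -> (p + size ts <= n)%N ->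
  let X := @Pplus_comp1s k P n x p
    [seq color1_op (tensor1_op y) | y <- ts] in
  F x (vseq n (s ++ [seq eval (tensor1_op y : P _) (tensor1_args y) | y <- ts]))
  = F (tagged X : P (tag X))
      (vseq (tag X) (s ++ flatten [seq codom (tensor1_args y) | y <- ts])).
Proof.
elim: ts p s => [|y ts IH] p s sp //= ptn.
have := IH p.+1 (rcons s (eval (tensor1_op y : P _) (tensor1_args y))).
rewrite size_rcons sp addSnnS => /(_ erefl ptn); rewrite !cat_rcons => ->.
have pX := comp1s_arity x p.+1 [seq color1_op (tensor1_op y) | y <- ts].
move: (Pplus_comp1s _ _ _) pX => [N x'] /= nN.
have pN : (p < N)%N by lia.
rewrite insubT /= (balanced_comp balF); congr F.
apply: eq_vnth => a aN; rewrite vnth_vseq // vnth_plug //=.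
have sz : size (codom (tensor1_args y)) = (tensor1_pred_arity y).+1.
  by rewrite size_codom card_ord.
case: eqP => [->|ap].
  rewrite nth_cat sp ltnn subnn /=; congr (eval _ _).
  apply/ffunP=> l; rewrite !ffunE vnth_vseq; last by have := ltn_ord l; lia.
  rewrite nth_cat sp ltnNge leq_addr /= addKn nth_cat sz ltn_ord.
  by rewrite (nth_map l) ?size_enum_ord // nth_ord_enum.
case: (ltnP a p) => ap'.
  by rewrite vnth_vseq ?nth_cat ?sp ?ap' //; lia.
rewrite vnth_vseq ?nth_cat ?sp; last by lia.
have -> : (a < p)%N = false by lia.
have -> : (a + tensor1_pred_arity y < p)%N = false by lia.
have -> : (a - p)%N = (a - p).-1.+1 by lia.
rewrite /= sz.
have -> : (a + tensor1_pred_arity y - p < (tensor1_pred_arity y).+1)%N = false.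
  by lia.
by congr nth; lia.
Qed.

(** A balanced family extends to the free module on pure tensors, then to the
   coinvariants [Pplus2], then to the coequalizer. *)
Definition dP_lift_free : {linear {malg k[tensor2 P V k^o]} -> W} :=
  malg_lift (fun t : tensor2 P V k^o =>
    (tensor2_coef t : k) *: F (tensor2_op t : P _) (tensor2_args t)).

Lemma dP_lift_freeU n (x : P n) v (z : k) :
  dP_lift_free (free2 (M := k^o) (x : Pplus P color2 n 1) v z) = z *: F x v.
Proof. exact: malg_liftU. Qed.

Fact dP_lift_free_rel a b : Pplus2_rel a b -> dP_lift_free a = dP_lift_free b.
Proof.
case=> [n r x y v z|n x v i r u w z|n x v r z t|n s x v z];
  rewrite ?linearP !dP_lift_freeU.
- by rewrite (balanced_op balF) scalerDr !scalerA mulrC.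
- by rewrite (balanced_arg balF) scalerDr !scalerA mulrC.
- by rewrite scalerDl scalerA.
- by rewrite (balanced_sym balF).
Qed.

Definition dP_lift_Pplus2 : {linear Pplus2 P V k^o -> W} :=
  linquot_lift dP_lift_free_rel.

Lemma dP_lift_Pplus2U n (x : P n) v (z : k) :
  dP_lift_Pplus2 (pure2 (M := k^o) (x : Pplus P color2 n 1) v z) = z *: F x v.
Proof. exact: etrans (linquot_liftE _ _) (dP_lift_freeU _ _ _). Qed.

Fact dP_lift_Pplus2_rel a b : coeq_rel (@action_map k P V k^o)
   (@composition_map k P V k^o) a b -> dP_lift_Pplus2 a = dP_lift_Pplus2 b.
Proof.
case=> [[n x t z]] [-> ->].
apply: etrans (dP_lift_Pplus2U _ _ _) (etrans _ (esym (dP_lift_Pplus2U _ _ _))).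
congr (_ *: _) => /=.
have st : (0 + size (codom t) <= n)%N by rewrite size_codom card_ord.
have /= <- := @balanced_comp1s n x 0 (codom t) [::] erefl st.
congr F; apply/ffunP=> i; rewrite !ffunE -map_comp.
by rewrite (nth_map i) ?size_enum_ord // nth_ord_enum.
Qed.

Definition dP_lift : {linear dP_circ V -> W} := linquot_lift dP_lift_Pplus2_rel.

Lemma dP_liftE n (x : P n) v :
  dP_lift (dP_class (x : Pplus P color2 n 1) v) = F x v.
Proof.
by apply: etrans (linquot_liftE _ _) _; rewrite dP_lift_Pplus2U scale1r.
Qed.

End Substitution.

Lemma relclass_scale n (x : P n) v (z : k) :
  @relclass k P V k^o n x v z = z *: @dP_class k P V n x v.
Proof.
have lin (r a b : k) : @relclass k P V k^o n x v (r * a + b : k) =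
   r *: @relclass k P V k^o n x v a + @relclass k P V k^o n x v b.
  rewrite /relclass -linearP; congr (lclass _ _).
  rewrite /pure2 -linearP; apply/lclassP/lincong_base.
  exact: Pplus2_coef.
have lin0 : @relclass k P V k^o n x v 0 = 0.
  by have := lin 1 0 0; rewrite mul1r addr0 scale1r => /(canLR (addrK _));
     rewrite subrr.
by rewrite -[in LHS](mulr1 z) -[z * 1]addr0 lin lin0 addr0.
Qed.

Lemma dP_ind (Q : dP_circ V -> Prop) :
  Q 0 -> (forall r a b, Q a -> Q b -> Q (r *: a + b)) ->
  (forall n (x : P n) v, Q (@dP_class k P V n x v)) -> forall a, Q a.
Proof.
move=> Q0 QD Qc a; rewrite -(lclass_repr a) -[repr a]lclass_repr.
move: (repr (repr a)); apply: malg_ind => [|r g h Qg Qh|[n x v z]].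
- by rewrite !linear0.
- by rewrite !linearP; apply: QD.
rewrite -[lclass _ _]/(@relclass k P V k^o n x v z) relclass_scale.
rewrite -[_ *: _]addr0.
exact: QD.
Qed.

Lemma dP_lin_eq (W : lmodType k) (f g : {linear dP_circ V -> W}) :
  (forall n (x : P n) v,
     f (@dP_class k P V n x v) = g (@dP_class k P V n x v)) ->
  f =1 g.
Proof.
move=> fg; apply: dP_ind => [|r a b ea eb|//]; first by rewrite !linear0.
by rewrite !linearP ea eb.
Qed.

Lemma comp1s_ids n (x : Pplus P color2 n 1) p r :
  (p + r <= n)%N ->
  Pplus_comp1s x p (nseq r (color1_op (idop P : Pplus P color1 1 0)))
  = Tagged (fun N => Pplus P color2 N 1) x.
Proof.
elim: r p => //= r IH p prn; rewrite IH; last by lia.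
have pn : (p < n)%N by lia.
rewrite insubT /= /Pplus_comp1 operad_idr.
by move: (esym _) => e; move: (addn0 n) e => -> e; rewrite eq_axiomK.
Qed.

Lemma comp1s_cat n (x : Pplus P color2 n 1) p s1 s2 :
  Pplus_comp1s x p (s1 ++ s2) =
  Pplus_comp1s (tagged (Pplus_comp1s x (p + size s1) s2)) p s1.
Proof.
elim: s1 p => [|y s1 IH] p /=.
  by rewrite addn0; case: (Pplus_comp1s _ _ _).
by rewrite IH addSnnS.
Qed.

Lemma codom_vnth n (u : {ffun 'I_n -> V}) :
  codom u = [seq vnth u a | a <- iota 0 n].
Proof.
rewrite -val_enum_ord -map_comp; apply: eq_map => i /=.
by rewrite vnth_ord.
Qed.

(** The coequalizer imposes simultaneous substitutions only; substituting y for
   one input is the case where the unit is substituted for the others. *)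
Lemma dP_class_comp n m (x : P n) (i : 'I_n) (y : P m)
    (u : {ffun 'I_(n + m) -> V}) :
  @dP_class k P V (n + m)%N (ocomp x (lift ord0 i) y) u =
  @dP_class k P V n x (plug i u (eval y)).
Proof.
(* y goes to position i and the unit to every other position. *)
pose ty : tensor1 V := @Tensor1 k P V m y [ffun l => u (inner i l)].
pose tid a : tensor1 V := @Tensor1 k P V 0 (idop P) [ffun=> vnth u a].
pose g (a : nat) :=
  if a == i then ty else tid (if (a < i)%N then a else a + m)%N.
pose t := [ffun j : 'I_n => g j].
have ni := ltn_ord i.
have nE : n = (i + (n - i.+1).+1)%N by lia.
have codom_t : codom t =
    map tid (iota 0 i)
    ++ ty :: map (fun a => tid (a + m)%N) (iota i.+1 (n - i.+1)).
  have -> : codom t = map g (iota 0 n).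
    rewrite -val_enum_ord -map_comp; apply: eq_map => j /=.
    by rewrite ffunE.
  rewrite [in LHS]nE iotaD map_cat add0n /= {2}/g eqxx; congr (_ ++ _ :: _).
    apply/eq_in_map=> a; rewrite mem_iota /g => /andP[_ ai].
    by rewrite add0n in ai; rewrite ltn_eqF // ai.
  apply/eq_in_map=> a; rewrite mem_iota /g => /andP[ia _].
  by rewrite gtn_eqF // ltnNge (ltnW ia).
have codom_u : flatten [seq codom (tensor1_args y) | y <- codom t] = codom u.
  rewrite codom_t map_cat flatten_cat /= -!map_comp.
  have flat1 (f : nat -> nat) s : flatten
      [seq ((fun y => codom (tensor1_args y)) \o (fun a => tid (f a))) a
         | a <- s]
      = [seq vnth u (f a) | a <- s].
    elim: s => //= a s ->.
    by rewrite codom_vnth /= (vnthE _ (ltn0Sn 0)) ffunE.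
  rewrite (flat1 id) (flat1 (addn^~ m)) !codom_vnth.
  have -> : iota 0 (n + m) = iota 0 (i + (m.+1 + (n - i.+1))).
    by congr iota; lia.
  rewrite !iotaD !map_cat; congr (_ ++ _ ++ _).
    rewrite add0n -[in RHS](addn0 i) iotaDl -map_comp; apply/eq_in_map=> l.
    rewrite mem_iota => /andP[_ lm]; rewrite (vnthE _ lm) ffunE /=.
    by rewrite -vnth_ord.
  rewrite add0n -addSnnS [(i.+1 + m)%N]addnC iotaDl -map_comp.
  by apply: eq_map => a /=; congr vnth; exact: addnC.
pose r : tensor21 V k^o := @Tensor21 k P V k^o n x t (1 : k).
have /lincong_base/lclassP : coeq_rel (@action_map k P V k^o)
    (@composition_map k P V k^o) (action_map r) (composition_map r).
  by exists r.
have -> : action_map r =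
    @pure2 k P V k^o n x (plug i u (eval y)) (1 : k).
  rewrite /action_map /=; congr pure2; apply/ffunP=> j; rewrite !ffunE /g.
  rewrite -val_eqE /=; case: ifP => //= ji.
  by rewrite eval_id ffunE -vnth_ord /=; case: ltnP.
have -> : composition_map r =
    @pure2 k P V k^o (n + m) (ocomp x (lift ord0 i) y) u (1 : k).
  rewrite /composition_map /= codom_u codom_t.
  set X := Pplus_comp1s _ _ _.
  have -> : X = Tagged (fun N => Pplus P color2 N 1)
     (ocomp x (lift ord0 i) y : Pplus P color2 (n + m) 1).
    rewrite /X map_cat comp1s_cat /= -!map_comp.
    have const (f : nat -> nat) s :
      [seq ((fun y : tensor1 V => color1_op (tensor1_op y))
              \o (fun a => tid (f a))) a | a <- s]
      = nseq (size s) (color1_op (idop P : Pplus P color1 1 0)).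
      by elim: s => //= a s ->.
    rewrite (const (addn^~ m)) (const id) size_nseq !size_iota add0n.
    rewrite (comp1s_ids x (p := i.+1)); last by lia.
    rewrite /= insubT /= comp1s_ids; last by lia.
    by congr (Tagged _ _); rewrite /Pplus_comp1; congr (ocomp _ (lift _ _) _);
       apply: val_inj.
  rewrite /=; congr pure2; apply: eq_vnth => a anm.
  rewrite vnth_vseq // codom_vnth (nth_map 0) ?size_iota //.
  by rewrite nth_iota.
by move=> e; exact: esym e.
Qed.

Definition dP_family n (x : P n) (v : {ffun 'I_n -> V}) : dP_circ V :=
  @dP_class k P V n x v.

Lemma balanced_class : balanced dP_family.
Proof.
split.
- move=> n v a x y; rewrite /dP_class /relclass -linearP; congr (lclass _ _).
  rewrite /pure2 -linearP; apply/lclassP/lincong_base.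
  exact: (@Pplus2_op k P V k^o n a x y v 1).
- move=> n x v i a u w; rewrite /dP_class /relclass -linearP.
  congr (lclass _ _).
  rewrite /pure2 -linearP; apply/lclassP/lincong_base.
  exact: Pplus2_arg.
- move=> n s x v; congr (lclass _ _); apply/lclassP/lincong_base.
  exact: (@Pplus2_sym k P V k^o n s x v 1).
- exact: dP_class_comp.
Qed.

Lemma balanced_Xgen : balanced (fun n (x : P n) v => Xgen (V := V) x v).
Proof.
split.
- move=> n v a x y; rewrite /Xgen -linearP; apply: aclass_base; exact: U_op.
- move=> n x v i a u w; rewrite /Xgen -linearP; apply: aclass_base.
  exact: U_arg.
- by move=> n s x v; apply: aclass_base; exact: U_sym.
- by move=> n m x i y v; apply: aclass_base; exact: U_comp.
Qed.

(** * The action of the enveloping algebra on the relative composite *)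

(** Left multiplication by the class of (x, v). *)
Definition dP_act (g : usymbol V) : {linear dP_circ V -> dP_circ V} :=
  dP_lift (balanced_left balanced_class (usymbol_op g) (usymbol_args g)).

Lemma dP_actE n (x : P n) v m (y : P m) w :
  dP_act (USymbol x v) (@dP_class k P V m y w) =
  @dP_class k P V (m + n) (ocomp y ord0 x) (vcat v w).
Proof. exact: dP_liftE. Qed.

Definition dP_one : dP_circ V :=
  dP_class (partial_op P (idop P)) [ffun i : 'I_0 => (0 : V)].

Notation act := (free_act dP_act).

Lemma act_freeX n (x : P n) v m (y : P m) w :
  act (freeX x v) (@dP_class k P V m y w) =
  @dP_class k P V (m + n) (ocomp y ord0 x) (vcat v w).
Proof. by rewrite /freeX free_act_gen dP_actE. Qed.

(** Each relation of U_P(V) holds between left multiplications because the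
   product is balanced in its first factor, associative and unital. *)
Lemma act_rel a b : U_rel (V := V) a b -> act a =1 act b.
Proof.
(* Both sides are linear in c, so c may be taken to be a class. *)
have bal m y w := balanced_right balanced_class (m := m) y w.
case=> [n r x y v|n x v i r u w|n s x v|n m x i y v|n m x y v w|v] c.
- rewrite free_act_linearl.
  rewrite -[RHS]/((r \*: act (freeX x v) \+ act (freeX y v)) c).
  move: c; apply: dP_lin_eq => m z c /=; rewrite !act_freeX.
  exact: (balanced_op (bal m z c)).
- rewrite free_act_linearl.
  rewrite -[RHS]/((r \*: act (freeX x (vset v i u))
                   \+ act (freeX x (vset v i w))) c).
  move: c; apply: dP_lin_eq => m z c /=; rewrite !act_freeX.
  exact: (balanced_arg (bal m z c)).
- move: c; apply: dP_lin_eq => m z c /=; rewrite !act_freeX.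
  exact: (balanced_sym (bal m z c)).
- move: c; apply: dP_lin_eq => p z c /=; rewrite !act_freeX.
  exact: (balanced_comp (bal p z c)).
- rewrite free_actM -[LHS]/((act (freeX x v) \o act (freeX y w)) c).
  move: c; apply: dP_lin_eq => p z c /=; rewrite !act_freeX.
  exact: (product_familyA dP_family).
- have -> : act 1 c = idfun c by exact: free_act1.
  move: c; apply: dP_lin_eq => p z c /=; rewrite act_freeX.
  exact: (product_family1 dP_family).
Qed.

(** The map u |-> u.1, where 1 is the class of the unit of the operad. *)
Definition U_to_dP : {linear Uenv V -> dP_circ V} :=
  linquot_lift (free_orbit_ideal dP_one act_rel).

Lemma U_to_dPE a : U_to_dP (aclass _ a) = act a dP_one.
Proof. exact: linquot_liftE. Qed.

Lemma U_to_dP_gen n (x : P n) v :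
  U_to_dP (Xgen x v) = @dP_class k P V n x v.
Proof. by rewrite U_to_dPE act_freeX; exact: (product_familyr1 dP_family). Qed.

Definition dP_to_U : {linear dP_circ V -> Uenv V} := dP_lift balanced_Xgen.

Lemma dP_to_UE n (x : P n) v : dP_to_U (@dP_class k P V n x v) = Xgen x v.
Proof. exact: dP_liftE. Qed.

Lemma dP_to_U_gen (g : usymbol V) c :
  dP_to_U (dP_act g c) = aclass (U_rel (V := V)) (free_gen k g) * dP_to_U c.
Proof.
case: g => n x v; move: c; apply: dP_ind => [|r a b ea eb|m y w].
- by rewrite !linear0 mulr0.
- by rewrite !linearP /= ea eb mulrDr algquot_scalerAr.
rewrite dP_actE !dP_to_UE -[RHS]aclassM; apply/esym/aclass_base; exact: U_mul.
Qed.

(** [dP_to_U] is a map of left U_P(V)-modules; as it preserves 1, it inverts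
   u |-> u.1. *)
Lemma dP_to_U_act a c :
  dP_to_U (act a c) = aclass (U_rel (V := V)) a * dP_to_U c.
Proof.
move: a; apply: free_alg_ind => [|r a b ea eb||g a ea].
- by rewrite free_act0 !linear0 mul0r.
- by rewrite free_act_linearl !linearP mulrDl -algquot_scalerAl -ea -eb.
- by rewrite free_act1 mul1r.
rewrite free_actM free_act_gen dP_to_U_gen ea mulrA -aclassM.
(* Both sides are the same product, written over two convertible forms of the
   type of symbols; the marker that separates them is removed before they are
   compared. *)
apply: (congr1 (fun z => z * dP_to_U c)); apply: congr1.
by rewrite /reverse_coercion.
Qed.

Lemma dP_to_UK : cancel dP_to_U U_to_dP.
Proof.
move=> c; rewrite -[LHS]/((U_to_dP \o dP_to_U) c) -[RHS]/(idfun c).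
by move: c; apply: dP_lin_eq => n x v /=; rewrite dP_to_UE U_to_dP_gen.
Qed.

Lemma dP_to_U1 : dP_to_U dP_one = 1.
Proof. by rewrite dP_to_UE; apply: aclass_base; exact: U_one. Qed.

Lemma U_to_dPK : cancel U_to_dP dP_to_U.
Proof.
apply: aclass_ind => a.
by rewrite U_to_dPE dP_to_U_act dP_to_U1 mulr1.
Qed.

Lemma U_to_dP1 : U_to_dP 1 = dP_one.
Proof. by rewrite -dP_to_U1 dP_to_UK. Qed.

(** * The product on the relative composite *)

(** Transported from U_P(V), so that bilinearity, associativity and the unit
   laws come for free. *)
Definition dP_mul (a b : dP_circ V) : dP_circ V :=
  U_to_dP (dP_to_U a * dP_to_U b).

Lemma dP_mul_linearl b : linear (dP_mul^~ b).
Proof.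
by move=> r a a'; rewrite /dP_mul linearP mulrDl -algquot_scalerAl linearP.
Qed.

Lemma dP_mul_linearr a : linear (dP_mul a).
Proof.
by move=> r b b'; rewrite /dP_mul linearP mulrDr -algquot_scalerAr linearP.
Qed.

Lemma dP_to_UM a b : dP_to_U (dP_mul a b) = dP_to_U a * dP_to_U b.
Proof. exact: U_to_dPK. Qed.

Lemma dP_mulA : associative dP_mul.
Proof.
move=> a b c; apply: (can_inj dP_to_UK).
apply: etrans (dP_to_UM a _) (etrans _ (esym (dP_to_UM _ c))).
apply: etrans (congr1 (fun u => dP_to_U a * u) (dP_to_UM b c)) _.
apply: etrans _ (esym (congr1 (fun u => u * dP_to_U c) (dP_to_UM a b))).
exact: mulrA.
Qed.

Lemma dP_mul_class : second_color_product dP_mul.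
Proof.
split; first by split; [exact: dP_mul_linearl | exact: dP_mul_linearr].
move=> n m x y v w; rewrite /dP_mul !dP_to_UE -aclassM.
apply: etrans (congr1 U_to_dP _) (U_to_dP_gen _ _).
by apply: aclass_base; exact: U_mul.
Qed.

Lemma second_color_product_unique mul mul' :
  second_color_product (V := V) mul -> second_color_product mul' ->
  forall a b, mul' a b = mul a b.
Proof.
move=> [[mull mulr] mulE] [[mull' mulr'] mulE'] a b.
have lin0 (f : dP_circ V -> dP_circ V) : linear f -> f 0 = 0.
  by move=> f_lin; have := f_lin (-1) 0 0; rewrite !scaleN1r oppr0 addr0 addNr.
move: a; apply: dP_ind => [|r a a' ea ea'|n x v].
- by rewrite (lin0 _ (mull b)) (lin0 _ (mull' b)).
- by rewrite mull mull' ea ea'.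
move: b; apply: dP_ind => [|r b b' eb eb'|m y w].
- by rewrite (lin0 _ (mulr _)) (lin0 _ (mulr' _)).
- by rewrite mulr mulr' eb eb'.
by rewrite mulE mulE'.
Qed.

End Universal.

Theorem proposition1p8 (k : fieldType) (char0 : [pchar k] =i pred0)
    (P : operad k) (V : operad_algebra P) :
  exists mul : dP_circ V -> dP_circ V -> dP_circ V,
    [/\ second_color_product mul,
        (forall mul', second_color_product mul' ->
           forall x y, mul' x y = mul x y),
        assoc_algebra mul
          (dP_class (partial_op P (idop P)) [ffun i : 'I_0 => (0 : V)]) &
        exists phi : {linear Uenv V -> dP_circ V},
          [/\ bijective phi,
              phi 1 =
                dP_class (partial_op P (idop P)) [ffun i : 'I_0 => (0 : V)],
              (forall x y, phi (x * y) = mul (phi x) (phi y)) &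
              (forall n (x : P n) (v : {ffun 'I_n -> V}),
                 phi (Xgen x v) = dP_class (partial_op P x) v)]].
Proof.
exists dP_mul; split.
- exact: dP_mul_class.
- by move=> mul' mulP; apply: second_color_product_unique mulP;
     exact: dP_mul_class.
- split.
  + by split; [exact: dP_mul_linearl | exact: dP_mul_linearr].
  + exact: dP_mulA.
  + by move=> a; rewrite /dP_mul dP_to_U1 mul1r dP_to_UK.
  + by move=> a; rewrite /dP_mul dP_to_U1 mulr1 dP_to_UK.
exists U_to_dP; split.
- by exists dP_to_U; [exact: U_to_dPK | exact: dP_to_UK].
- exact: U_to_dP1.
- by move=> a b; rewrite /dP_mul !U_to_dPK.
exact: U_to_dP_gen.
Qed.
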